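(* Let $f:\{\mathtt{1},\mathtt{2},\mathtt{3}\}^*\to\{\mathtt{1},\mathtt{2},\mathtt{3}\}^*$ be the $24$-uniform morphism defined by \begin{align*} \mathtt{1}&\mapsto \mathtt{123132312132123213231321},\\ \mathtt{2}&\mapsto \mathtt{231213123213231321312132},\\ \mathtt{3}&\mapsto \mathtt{312321231321312132123213}. \end{align*} Then the infinite word $f^\omega(\mathtt{1})$ (the fixed point of $f$ beginning with $\mathtt{1}$) is undirected $\tfrac{7}{4}^+$-free.
   Context: For a word $x=x_1x_2\cdots x_n$ (the $x_i$ letters), its reversal is $x^R=x_n\cdots x_2x_1$. For a rational number $1<r\le 2$, an undirected $r$-power is a word of the form $xyx'$ where $x$ is a nonempty word, $x'\in\{x,x^R\}$, and $|xyx'|/|xy|=r$. A (finite or infinite) word $w$ is undirected $\alpha^+$-free if no factor of $w$ is an undirected $r$-power for any $r>\alpha$. *)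

(* Defs.v *)
From mathcomp Require Import all_boot all_order all_algebra.

Set Implicit Arguments.
Unset Strict Implicit.
Unset Printing Implicit Defensive.

Import Order.TTheory GRing.Theory Num.Theory.

(* The middle word y may be empty; the ratio r is then 2. *)
Definition undirected_power (A : Type) (r : rat) (u : seq A) : Prop :=
  (1 < r <= 2)%R /\
  exists x y x' : seq A,
    [/\ u = x ++ y ++ x', x <> [::], x' = x \/ x' = rev x &
        ((size (x ++ y ++ x'))%:R / (size (x ++ y))%:R)%R = r].

(* Infinite words over A are functions nat -> A, indexed from 0. *)
Definition iprefix (A : Type) (w : nat -> A) (n : nat) : seq A := mkseq w n.

Definition ifactor (A : Type) (w : nat -> A) (u : seq A) : Prop :=
  exists i n : nat, u = mkseq (fun j => w (i + j)) n.

Definition undirected_plus_free (A : Type) (alpha : rat) (w : nat -> A) : Prop :=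
  forall (r : rat) (u : seq A),
    (alpha < r)%R -> ifactor w u -> ~ undirected_power r u.

(* A morphism of free monoids is given by the images of the letters. *)
Definition morph (A B : Type) (h : A -> seq B) (u : seq A) : seq B :=
  flatten [seq h a | a <- u].

(* h^omega(a), the limit of the words h^n(a). It is meaningful when h(a) begins
   with a and |h^n(a)| > n for all n, so that the default value a of nth is never
   used; see omega_iter, omega_fixed and omega_unique below. *)
Definition omega (A : Type) (h : A -> seq A) (a : A) (n : nat) : A :=
  nth a (iter n (morph h) [:: a]) n.

Inductive letter : Type := L1 | L2 | L3.

Definition f (a : letter) : seq letter :=
  match a with
  | L1 => [:: L1; L2; L3; L1; L3; L2; L3; L1; L2; L1; L3; L2;
             L1; L2; L3; L2; L1; L3; L2; L3; L1; L3; L2; L1]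
  | L2 => [:: L2; L3; L1; L2; L1; L3; L1; L2; L3; L2; L1; L3;
             L2; L3; L1; L3; L2; L1; L3; L1; L2; L1; L3; L2]
  | L3 => [:: L3; L1; L2; L3; L2; L1; L2; L3; L1; L3; L2; L1;
             L3; L1; L2; L1; L3; L2; L1; L2; L3; L2; L1; L3]
  end.

Lemma morph_cat (A B : Type) (h : A -> seq B) (u v : seq A) :
  morph h (u ++ v) = morph h u ++ morph h v.
Proof. by rewrite /morph map_cat flatten_cat. Qed.

Lemma size_f (a : letter) : size (f a) = 24.
Proof. by case: a. Qed.

Lemma size_morph_f (u : seq letter) : size (morph f u) = 24 * size u.
Proof.
elim: u => [|a u IHu]; first by rewrite muln0.
by rewrite -cat1s morph_cat size_cat IHu /morph /= cats0 size_f mulnS.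
Qed.

Lemma size_iter_f (n : nat) : size (iter n (morph f) [:: L1]) = 24 ^ n.
Proof. by elim: n => [//|n IHn]; rewrite iterS size_morph_f IHn expnS. Qed.

Lemma iter_f_extend (m k : nat) : exists v : seq letter,
  iter (m + k) (morph f) [:: L1] = iter m (morph f) [:: L1] ++ v.
Proof.
elim: m => [|m [v Hv]]; last first.
  by exists (morph f v); rewrite addSn !iterS Hv morph_cat.
elim: k => [|k [v Hv]]; first by exists [::].
rewrite add0n in Hv; rewrite add0n iterS Hv morph_cat /=.
by exists (behead (f L1) ++ morph f v).
Qed.

Lemma omega_iter (n : nat) :
  iprefix (omega f L1) (24 ^ n) = iter n (morph f) [:: L1].
Proof.
apply: (@eq_from_nth _ L1) => [|i]; rewrite size_mkseq ?size_iter_f // => lti.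
rewrite nth_mkseq // /omega.
have [le_in|/ltnW le_ni] := leqP i n.
  have [v] := iter_f_extend i (n - i); rewrite subnKC // => ->.
  by rewrite nth_cat size_iter_f ltn_expl.
have [v] := iter_f_extend n (i - n); rewrite subnKC // => ->.
by rewrite nth_cat size_iter_f lti.
Qed.

Lemma size_iprefix (A : Type) (w : nat -> A) (n : nat) : size (iprefix w n) = n.
Proof. exact: size_mkseq. Qed.

Lemma iprefix_cat (A : Type) (w : nat -> A) (m n : nat) :
  iprefix w (m + n) = iprefix w m ++ mkseq (fun j => w (m + j)) n.
Proof.
rewrite /iprefix /mkseq iotaD map_cat add0n.
by rewrite -[in X in iota X n](addn0 m) iotaDl -map_comp.
Qed.

Lemma omega_fixed (n : nat) :
  morph f (iprefix (omega f L1) n) = iprefix (omega f L1) (24 * n).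
Proof.
have sub k m : k <= m -> iprefix (omega f L1) k = take k (iprefix (omega f L1) m).
  by move=> le_km; rewrite -(subnKC le_km) iprefix_cat take_size_cat ?size_iprefix.
have le_n : n <= 24 ^ n by rewrite ltnW // ltn_expl.
have le_n24 : 24 * n <= 24 ^ n.+1 by rewrite expnS leq_mul2l.
rewrite (sub _ _ le_n24) (sub _ _ le_n) !omega_iter iterS.
set u := iter n _ _; rewrite -{2}(cat_take_drop n u) morph_cat.
by rewrite take_size_cat // size_morph_f size_takel // size_iter_f.
Qed.

Lemma omega_unique (w : nat -> letter) :
    w 0 = L1 ->
    (forall n : nat, morph f (iprefix w n) = iprefix w (24 * n)) ->
  w =1 omega f L1.
Proof.
move=> w0 fw n.
have itw k : iprefix w (24 ^ k) = iter k (morph f) [:: L1].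
  by elim: k => [|k IHk]; [rewrite /iprefix /mkseq /= w0 | rewrite expnS -fw IHk].
by rewrite /omega -itw nth_mkseq // ltn_expl.
Qed.

(* Main.v *)
(** The first 16 letters of a factor of the fixed point determine its position
modulo 24, and distinct letters have images that differ in every column. So a
repetition [x y x] of period [p] with [|x| > 3p/4] and [|x| >= 16] has [p]
divisible by 24, and the blocks meeting it form a repetition of period [p/24]
of the same kind; descending reaches a period below 20. A repetition
[x y x^R] has [|x| < 19], as no factor of length 19 has its reversal as a
factor. Both bounded cases are inspections of the images of three-letter words
without equal adjacent letters. *)

Require Import Defs.
From HB Require Import structures.
From mathcomp Require Import all_boot all_order all_algebra.
From mathcomp Require Import zify.

Set Implicit Arguments.
Unset Strict Implicit.
Unset Printing Implicit Defensive.

Import Order.TTheory GRing.Theory Num.Theory.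

Definition letter_eqb (a b : letter) : bool :=
  match a, b with L1, L1 | L2, L2 | L3, L3 => true | _, _ => false end.

Lemma letter_eqP : Equality.axiom letter_eqb.
Proof. by move=> [] []; constructor. Qed.

HB.instance Definition _ := hasDecEq.Build letter letter_eqP.

Local Notation w := (omega f L1).

Definition window (i n : nat) : seq letter := mkseq (fun k => w (i + k)) n.

Lemma take_window i m n : m <= n -> take m (window i n) = window i m.
Proof. by move=> le_mn; rewrite /window /mkseq -map_take take_iota (minn_idPl le_mn). Qed.

Lemma drop_window i m n : drop m (window i n) = window (i + m) (n - m).
Proof.
apply: (@eq_from_nth _ L1) => [|k]; rewrite size_drop !size_mkseq // => lt_k.
by rewrite nth_drop !nth_mkseq ?addnA //; lia.
Qed.

Lemma window_block q n : window (24 * q) (24 * n) = morph f (window q n).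
Proof.
have := omega_fixed (q + n).
rewrite mulnDr (iprefix_cat _ q) (iprefix_cat _ (24 * q)) morph_cat => /(congr1 (drop (24 * q))).
by rewrite !drop_size_cat ?size_morph_f ?size_iprefix.
Qed.

Lemma window_morph i n m : i %% 24 + n <= 24 * m ->
  window i n = take n (drop (i %% 24) (morph f (window (i %/ 24) m))).
Proof.
move=> le_nm; rewrite -window_block drop_window take_window; last by lia.
by rewrite mulnC -divn_eq.
Qed.

Lemma omegaE i : w i = nth L1 (f (w (i %/ 24))) (i %% 24).
Proof.
have lt24 : i %% 24 < 24 by rewrite ltn_mod.
have := @window_morph i 1 1; rewrite addn1 muln1 => /(_ lt24).
rewrite /window /mkseq /= !addn0 /morph /= cats0.
move=> /(congr1 (fun s => nth L1 s 0)) /= ->.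
by rewrite nth_take // nth_drop addn0.
Qed.

(** Strong induction on the position: both letters lie in the image of the pair at [i %/ 24] and its
    successor, which is unequal by induction, so only the images of two distinct letters need
    inspection. *)
Lemma omega_adjacent i : w i != w i.+1.
Proof.
elim/ltn_ind: i => i IHi.
have chk a b : a != b ->
    all (fun t => nth L1 (f a ++ f b) t != nth L1 (f a ++ f b) t.+1) (iota 0 24).
  by case: a; case: b.
have [-> //|i_gt0] := posnP i.
have lt_qi : i %/ 24 < i by rewrite ltn_Pdiv.
have /allP/(_ (i %% 24)) := chk _ _ (IHi _ lt_qi).
rewrite mem_iota /= ltn_mod => /(_ isT).
have two : i %% 24 + 2 <= 24 * 2 by have := @ltn_pmod i 24 isT; lia.
have := window_morph two.
rewrite /window /mkseq /= !addn0 !addn1 /morph /= cats0.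
move=> E; have := congr1 (fun s => nth L1 s 0) E; have := congr1 (fun s => nth L1 s 1) E.
by rewrite /= !nth_take // !nth_drop addn0 addn1 => <- <-.
Qed.

(** A finite superset of the factors of length [n], small enough for exhaustive checks. *)
Fixpoint proper_words (n : nat) : seq (seq letter) :=
  if n is n'.+1 then
    [seq a :: u | a <- [:: L1; L2; L3],
                  u <- [seq v <- proper_words n' | path (fun b c => b != c) a v]]
  else [:: [::]].

Lemma window_proper i n : window i n \in proper_words n.
Proof.
elim: n i => [//|n IHn] i.
have windowS m : window i m.+1 = w i :: window i.+1 m.
  apply: (@eq_from_nth _ L1) => [|[|k]]; first by rewrite /= !size_map !size_iota.
    by rewrite /= addn0.
  rewrite size_mkseq => lt_k; rewrite nth_mkseq //.
  by rewrite -[RHS]/(nth L1 (window i.+1 m) k) nth_mkseq // addSnnS.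
rewrite windowS; apply/allpairsPdep; exists (w i), (window i.+1 n); split=> //.
  by case: (w i).
rewrite mem_filter IHn andbT; apply/(pathP L1) => k.
rewrite size_mkseq => lt_kn; rewrite -windowS !nth_mkseq //; last exact: ltnW.
by rewrite addSn; apply: omega_adjacent.
Qed.

(* Each candidate window is paired with its position modulo 24. *)
Definition candidates (n m : nat) : seq (nat * seq letter) :=
  [seq (t, take n (drop t (morph f u))) | u <- proper_words m, t <- iota 0 24].

(** The offset in the first block is at most 23, so [m] blocks cover the window. *)
Lemma window_candidate i n m :
  23 + n <= 24 * m -> (i %% 24, window i n) \in candidates n m.
Proof.
move=> le_nm; have lt24 : i %% 24 < 24 by rewrite ltn_mod.
apply/allpairsPdep; exists (window (i %/ 24) m), (i %% 24); split.
- exact: window_proper.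
- by rewrite mem_iota.
- by congr pair; apply: window_morph; lia.
Qed.

Lemma window_sync i j : window i 16 = window j 16 -> i %% 24 = j %% 24.
Proof.
have chk : allrel (fun x y => (x.2 == y.2) ==> (x.1 == y.1))
    (candidates 16 2) (candidates 16 2) by vm_compute.
move=> eq_ij; have /allrelP/(_ _ _ (window_candidate i _) (window_candidate j _)) := chk.
by rewrite /= eq_ij eqxx => /(_ isT isT) /eqP.
Qed.

Lemma window_rev_neq i j : window j 19 <> rev (window i 19).
Proof.
have chk : allrel (fun x y => y.2 != rev x.2) (candidates 19 2) (candidates 19 2).
  by vm_compute.
have /allrelP/(_ _ _ (window_candidate i _) (window_candidate j _)) := chk.
by move=> /(_ isT isT) /eqP.
Qed.

(** The length [(3 * p %/ 4).+1] is the least [m] with [3 * p < 4 * m]; longer repetitions of period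
    [p] restrict to it. *)
Lemma short_repetition i p : 0 < p < 20 ->
  window (i + p) (3 * p %/ 4).+1 <> window i (3 * p %/ 4).+1.
Proof.
have chk : all (fun x => all (fun p =>
    take (3 * p %/ 4).+1 (drop p x.2) != take (3 * p %/ 4).+1 x.2) (iota 1 19))
  (candidates 41 3) by vm_compute.
move=> p_bd; have /allP/(_ _ (window_candidate i _)) := chk.
move=> /(_ isT) /allP /(_ p); rewrite mem_iota => /(_ p_bd) /eqP.
rewrite -[(_, _).2]/(window i 41) {chk}.
by rewrite drop_window !take_window //; lia.
Qed.

Lemma short_reversal i m d : 3 * d < m < 19 ->
  window (i + (m + d)) m <> rev (window i m).
Proof.
(* Here [m <= 18] forces [d <= 5], so the whole factor has length at most 18 + 5 + 18 = 41. *)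
have chk : all (fun x => all (fun m => all (fun d => (3 * d < m) ==>
    (take m (drop (m + d) x.2) != rev (take m x.2))) (iota 0 6)) (iota 1 18))
  (candidates 41 3) by vm_compute.
move=> /andP[lt_dm lt_m]; have /allP/(_ _ (window_candidate i _)) := chk.
move=> /(_ isT) /allP /(_ m); rewrite mem_iota => /(_ ltac:(lia)).
move=> /allP /(_ d); rewrite mem_iota lt_dm => /(_ ltac:(lia)) /eqP.
rewrite -[(_, _).2]/(window i 41) {chk}.
by rewrite drop_window !take_window //; lia.
Qed.

Lemma f_column_inj t a b : t < 24 -> nth L1 (f a) t = nth L1 (f b) t -> a = b.
Proof.
move=> lt_t /eqP eq_ab; apply/eqP; move: eq_ab; apply/implyP.
have chk : all (fun t => (nth L1 (f a) t == nth L1 (f b) t) ==> (a == b)) (iota 0 24).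
  by case: a; case: b; vm_compute.
by move/allP: chk; apply; rewrite mem_iota.
Qed.

Lemma no_repetition p i m : 0 < p -> 3 * p < 4 * m -> window (i + p) m <> window i m.
Proof.
elim/ltn_ind: p i m => p IHp i m p_gt0 lt_pm eq_w.
have sub n : n <= m -> window (i + p) n = window i n.
  by move=> le_nm; rewrite -!(@take_window _ n m) // eq_w.
have [p_small|p_big] := ltnP p 20.
  by apply: (@short_repetition i p); [lia | apply: sub; lia].
(* From [p >= 20] follows [4 * m > 60]: this is where the threshold 20 comes from. *)
have le16 : 16 <= m by lia.
have mod_p := window_sync (sub 16 le16).
have [q def_p] : exists q, p = 24 * q by exists (p %/ 24); lia.
(* The new length, a quotient rounded up, counts all blocks meeting [window i m], including partial
   ones. *)
apply: (IHp q _ (i %/ 24) ((i %% 24 + m + 23) %/ 24)); [lia..|].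
apply/eq_in_map => k; rewrite mem_iota add0n /= => lt_k.
(* The first position of block [i %/ 24 + k] inside the window; one shared column suffices to
   identify the letters of the two blocks. *)
pose s := maxn i (24 * (i %/ 24 + k)).
have divs : s %/ 24 = i %/ 24 + k by rewrite /s; lia.
have divsp : (s + p) %/ 24 = i %/ 24 + q + k by rewrite /s; lia.
have modsp : (s + p) %% 24 = s %% 24 by rewrite /s; lia.
have /(congr1 (fun u => nth L1 u (s - i))) := eq_w.
rewrite !nth_mkseq; [|rewrite /s; lia..].
have -> : i + p + (s - i) = s + p by rewrite /s; lia.
have -> : i + (s - i) = s by rewrite /s; lia.
by rewrite (omegaE (s + p)) (omegaE s) divs divsp modsp; apply: f_column_inj; rewrite ltn_mod.
Qed.

Lemma no_reversal i m d : 3 * d < m -> window (i + (m + d)) m <> rev (window i m).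
Proof.
move=> lt_dm eq_w; have [lt_m|le_m] := ltnP m 19.
  by apply: (@short_reversal i m d) eq_w; lia.
move/(congr1 (take 19)): eq_w.
(* The first 19 letters of the reversal are the last 19 letters of [window i m], reversed. *)
rewrite take_window // take_rev size_mkseq drop_window subKn //.
exact: window_rev_neq.
Qed.

Theorem theorem2 : undirected_plus_free (7%:R / 4%:R)%R (omega f L1).
Proof.
move=> r u lt_r [i [n def_u]] [_ [x [y [x' [def_xy x_neq0 x'_x def_r]]]]].
have size_x' : size x' = size x by case: x'_x => ->; rewrite ?size_rev.
have x_gt0 : 0 < size x by case: x x_neq0 {def_xy x'_x def_r size_x'}.
(* Clearing denominators in (2|x| + |y|) / (|x| + |y|) > 7/4. With [p] = |x| + |y| this is also 3p <
   4|x|. *)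
have lt_yx : 3 * size y < size x.
  move: lt_r; rewrite -def_r ltr_pdivlMr; last by rewrite ltr0n size_cat; lia.
  rewrite mulrAC ltr_pdivrMr ?ltr0n // -!natrM ltr_nat !size_cat size_x'; lia.
have size_u : n = size x + (size y + size x).
  by rewrite -(size_mkseq (fun j => w (i + j)) n) -def_u def_xy !size_cat size_x'.
have def_win : window i n = x ++ y ++ x' by rewrite -def_xy def_u.
have def_x : window i (size x) = x.
  by rewrite -(@take_window _ _ n) ?def_win ?take_size_cat //; lia.
have def_x' : window (i + (size x + size y)) (size x) = x'.
  have -> : size x = n - (size x + size y) by lia.
  have -> : n - (size x + size y) + size y = size x + size y by lia.
  by rewrite -drop_window def_win catA drop_size_cat ?size_cat.
case: x'_x => eq_x'; rewrite eq_x' in def_x'.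
  by apply: (@no_repetition (size x + size y) i (size x)); [lia | lia | rewrite def_x].
by apply: (no_reversal lt_yx (i := i)); rewrite def_x.
Qed.
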